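(* Let $(B,+,\circ)$ be a skew brace. Suppose that for each $b\in B$ which has odd order or infinite order in $(B,+)$ or in $(B,\circ)$, either $\langle b\rangle_\circ$ or $\langle b\rangle_+$ is an ideal of $B$. Then $\langle b\rangle_+=\langle b\rangle_\circ$ for each such $b$. Moreover, the sub-skew brace $C$ generated by the elements of $B$ which have infinite additive (or multiplicative) order is a trivial brace.
   Context: A skew brace is a triple $(B,+,\circ)$ with $(B,+)$, $(B,\circ)$ (not necessarily abelian) groups such that $a\circ(b+c)=a\circ b-a+a\circ c$ for all $a,b,c\in B$. For $a\in B$ put $\lambda_a(b)=-a+a\circ b$; then $\lambda:a\mapsto\lambda_a$ is a homomorphism $(B,\circ)\to\operatorname{Aut}(B,+)$. A sub-skew brace is a subset that is a subgroup of both $(B,+)$ and $(B,\circ)$; the sub-skew brace generated by a subset is the smallest one containing it. An ideal is a subgroup of $(B,+)$ that is normal in $(B,+)$, invariant under all $\lambda_b$, and normal in $(B,\circ)$. $B$ is trivial (a trivial brace) if $a+b=a\circ b$ for all $a,b\in B$. $\langle b\rangle_+$ and $\langle b\rangle_\circ$ denote the subgroups generated by $b$ in $(B,+)$ and $(B,\circ)$ respectively. The additive (multiplicative) order of an element is its order in $(B,+)$ (in $(B,\circ)$). *)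

(* Defs.v *)
From HB Require Import structures.
From mathcomp Require Import all_boot.
From mathcomp Require Import boolp classical_sets.

Set Implicit Arguments.
Unset Strict Implicit.
Unset Printing Implicit Defensive.

Local Open Scope classical_set_scope.

Section Groups.
Local Open Scope group_scope.
Variable G : groupType.

Definition subgroup (H : set G) : Prop :=
  [/\ H 1, forall x y, H x -> H y -> H (x * y) & forall x, H x -> H x^-1].

Definition normal_subgroup (N : set G) : Prop :=
  subgroup N /\ forall x g, N x -> N (x ^ g).

Definition cyclic_subgroup (x : G) : set G := smallest subgroup [set x].

Definition has_order (x : G) (n : nat) : Prop :=
  [/\ (0 < n)%N, x ^+ n = 1 & forall m, (0 < m)%N -> x ^+ m = 1 -> (n <= m)%N].

Definition odd_order (x : G) : Prop := exists2 n, has_order x n & odd n.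

Definition infinite_order (x : G) : Prop := ~ exists n, has_order x n.

End Groups.

Declare Scope skew_brace_scope.
Delimit Scope skew_brace_scope with sb.

(* The circle operation is the product of the [groupType] structure. The
   additive group need not be abelian, hence is not a [zmodType]. *)
HB.mixin Record isSkewBrace B of Group B := {
  sbadd : B -> B -> B;
  sbzero : B;
  sbopp : B -> B;
  sbaddA : associative sbadd;
  sbadd0 : left_id sbzero sbadd;
  sbaddN : left_inverse sbzero sbopp sbadd;
  sbmul_add : forall a b c : B,
    (a * sbadd b c = sbadd (sbadd (a * b) (sbopp a)) (a * c))%g
}.

#[short(type="skewBraceType")]
HB.structure Definition SkewBrace := {B of Group B & isSkewBrace B}.

Notation "a + b" := (sbadd a b) : skew_brace_scope.
Notation "- a" := (sbopp a) : skew_brace_scope.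
Notation "0" := (@sbzero _) : skew_brace_scope.
Notation "a ∘ b" := (@mul _ a b)
  (at level 40, left associativity) : skew_brace_scope.

(* The same carrier, seen as the group (B, +) written multiplicatively. *)
Definition addgroup (B : skewBraceType) : Type := B.

Section AddGroup.
Local Open Scope skew_brace_scope.
Variable B : skewBraceType.

Lemma sbaddrN : right_inverse (0 : B) (@sbopp B) (@sbadd B).
Proof.
move=> a; rewrite -[LHS]sbadd0 -{1}(sbaddN (- a)) -sbaddA (sbaddA (- a)).
by rewrite sbaddN sbadd0 sbaddN.
Qed.

Lemma sbaddr0 : right_id (0 : B) (@sbadd B).
Proof. by move=> a; rewrite -(sbaddN a) sbaddA sbaddrN sbadd0. Qed.

HB.instance Definition _ := Choice.copy (addgroup B) B.
HB.instance Definition _ := isGroup.Build (addgroup B)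
  (@sbaddA B) (@sbadd0 B) sbaddr0 (@sbaddN B) sbaddrN.

End AddGroup.

Section SkewBraces.
Local Open Scope skew_brace_scope.
Variable B : skewBraceType.
Implicit Types (a b : B) (I S : set B).

Definition lambda a b : B := - a + a ∘ b.

Definition cyclic_add b : set B := @cyclic_subgroup (addgroup B) b.
Definition cyclic_circ b : set B := @cyclic_subgroup B b.

Definition infinite_order_add b : Prop := @infinite_order (addgroup B) b.
Definition infinite_order_circ b : Prop := @infinite_order B b.

Definition odd_order_add b : Prop := @odd_order (addgroup B) b.
Definition odd_order_circ b : Prop := @odd_order B b.

Definition sub_skew_brace S : Prop :=
  @subgroup (addgroup B) S /\ @subgroup B S.

Definition generated_sub_skew_brace S : set B := smallest sub_skew_brace S.

Definition ideal I : Prop :=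
  [/\ @normal_subgroup (addgroup B) I,
      forall b x, I x -> I (lambda b x)
    & @normal_subgroup B I].

(* Triviality of the skew brace structure carried by the sub-skew brace [S]. *)
Definition trivial_brace S : Prop :=
  forall a b, S a -> S b -> a + b = a ∘ b.

Definition odd_or_infinite_order b : Prop :=
  (odd_order_add b \/ infinite_order_add b) \/
  (odd_order_circ b \/ infinite_order_circ b).

End SkewBraces.

(* Main.v *)
Require Import Defs.
From HB Require Import structures.
From mathcomp Require Import all_boot.
From mathcomp Require Import ssralg ssrnum ssrint intdiv fingroup cyclic.
From mathcomp Require Import boolp classical_sets zify.
From mathcomp Require Import generic_quotient.

(** Write [<b>_+] and [<b>_∘] for the two cyclic subgroups of [b]. The argument rests on one
    observation, [lambda_prime_order]: if [b] is a nonzero element with [p b = 0] for a prime [p], and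
    [lambda b b] is the multiple [j b], then [j] is 1 modulo [p]; otherwise the translation by [b]
    in the multiplicative group would have a fixed point. It is applied in quotients by ideals
    contained in the cyclic ideal that is being studied.

    Suppose first that [<b>_+] is an ideal. Its subgroups are stable under [lambda], so if [x] is one
    of its elements then [<x>_∘] is contained in [<x>_+]; hence [<x>_+] is an ideal whenever one of the
    two is. On [<b>_+] the map [lambda b] is the multiplication by some [r], and [b ^ m] is the
    geometric sum [1 + r + ... + r ^ (m - 1)] times [b]. If [b] has infinite additive order, then [r]
    is 1 modulo every prime, so [r = 1] and the powers of [b] are its multiples
    ([add_ideal_infinite_lambda]). If the additive order [n] is odd, then [r] is 1 modulo each prime
    divisor of [n], and a divisibility property of geometric sums ([dvdn_geom_sum]) shows that the
    multiplicative order is [n] as well ([add_ideal_odd]). If [n] is even then so is the multiplicative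
    order ([add_ideal_even_circ]), so that [b] is not one of the elements under consideration.

    Consequently [<b>_∘] is an ideal for every element [b] of odd or infinite order. If [b] has
    infinite multiplicative order, all the [<b ^ p>_∘] are ideals, and [lambda b b = b] modulo each of
    them, hence [lambda b b = b] ([circ_ideals_infinite]). In the finite case the multiplicative order
    turns out to be odd ([circ_order_odd]), and an induction on it ([circ_odd_ideals]) reduces the
    claim to an impossible skew brace of order [p ^ 2] ([no_unipotent]), where the oddness of [p]
    enters through the binomial coefficient [C(p, 2)].

    Finally, let [b] and [c] have infinite order. Both generate ideals that are trivial braces, and
    [lambda c] fixes [b], whether these ideals intersect trivially or not ([infinite_lambda]). So the
    two operations agree on the additive subgroup generated by all such elements. *)

Set Implicit Arguments.
Unset Strict Implicit.
Unset Printing Implicit Defensive.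

Local Open Scope classical_set_scope.

(** * Integer powers, orders and cyclic subgroups *)

Section Powers.
Local Open Scope group_scope.
Variable G : groupType.
Implicit Types (x y : G) (k l : int).

Definition zexp x k : G :=
  match k with Posz n => x ^+ n | Negz n => (x ^+ n.+1)^-1 end.

Lemma zexp_opp x k : zexp x (- k)%R = (zexp x k)^-1.
Proof.
case: k => [[|n]|n]; first by rewrite /= expg0 invg1.
- by rewrite -NegzE.
by rewrite NegzE GRing.opprK /= invgK.
Qed.

Lemma zexp_succ x k : zexp x (k + 1)%R = zexp x k * x.
Proof.
case: k => [n|[|n]].
- by rewrite -PoszD addn1 /= expgSr.
- by rewrite NegzE GRing.addNr /= expg1 mulVg.
have -> : (Negz n.+1 + 1)%R = Negz n by lia.
by rewrite /= [in RHS]expgS invgM mulgVK.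
Qed.

Lemma zexpD x k l : zexp x (k + l)%R = zexp x k * zexp x l.
Proof.
have pos m n : zexp x (m + Posz n)%R = zexp x m * x ^+ n.
  elim: n => [|n IHn]; first by rewrite GRing.addr0 expg0 mulg1.
  have -> : (m + Posz n.+1 = (m + Posz n) + 1)%R by lia.
  by rewrite zexp_succ IHn expgSr mulgA.
case: l => [n|n]; first exact: pos.
by apply: (can_inj (mulgK (x ^+ n.+1))); rewrite -pos NegzE GRing.subrK zexp_opp mulgVK.
Qed.

Lemma zexp1n k : zexp (1 : G) k = 1.
Proof. by case: k => n /=; rewrite expg1n ?invg1. Qed.

Lemma zexpM x k l : zexp x (k * l)%R = zexp (zexp x k) l.
Proof.
have pos n : zexp x (k * Posz n)%R = zexp x k ^+ n.
  elim: n => [|n IHn]; first by rewrite GRing.mulr0.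
  have -> : (k * Posz n.+1 = k * Posz n + k)%R by lia.
  by rewrite zexpD IHn expgSr.
case: l => n; first exact: pos.
by rewrite NegzE GRing.mulrN !zexp_opp pos.
Qed.

Lemma zexpAC x k l : zexp (zexp x k) l = zexp (zexp x l) k.
Proof. by rewrite -!zexpM GRing.mulrC. Qed.

Lemma subgroup_zexp (H : set G) x k : subgroup H -> H x -> H (zexp x k).
Proof.
move=> [H1 HM HV] Hx.
have pos n : H (x ^+ n) by elim: n => [|n IHn]; rewrite ?expgS; auto.
by case: k => n /=; auto.
Qed.

Lemma smallest_subgroup (S : set G) : subgroup (smallest (@subgroup G) S).
Proof.
split=> [|y z Hy Hz|y Hy] K HK; have [[K1 KM KV] _] := HK; first exact: K1.
- exact: KM (Hy K HK) (Hz K HK).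
- exact: KV (Hy K HK).
Qed.

Lemma cyclic_subgroup_subgroup x : subgroup (cyclic_subgroup x).
Proof. exact: smallest_subgroup. Qed.

Lemma cyclic_subgroupP x y : cyclic_subgroup x y <-> exists k, y = zexp x k.
Proof.
split=> [|[k ->]]; last first.
  by apply: (subgroup_zexp _ (cyclic_subgroup_subgroup x)); apply: sub_gen_smallest.
apply: (smallest_sub (X := [set y | exists k, y = zexp x k])) => [|_ ->].
  split; first by exists 0%R.
  - by move=> _ _ [k ->] [l ->]; exists (k + l)%R; rewrite zexpD.
  - by move=> _ [k ->]; exists (- k)%R; rewrite zexp_opp.
by exists 1%R; rewrite /= expg1.
Qed.

Lemma cyclic_subgroup_zexp x k : cyclic_subgroup x (zexp x k).
Proof. by apply/cyclic_subgroupP; exists k. Qed.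

Lemma cyclic_subgroup_id x : cyclic_subgroup x x.
Proof. exact: sub_gen_smallest. Qed.

Lemma cyclic_subgroup_sub (H : set G) x :
  subgroup H -> H x -> cyclic_subgroup x `<=` H.
Proof. by move=> HH Hx; apply: smallest_sub => // _ ->. Qed.

Lemma has_order_of_expg x m :
  (0 < m)%N -> x ^+ m = 1 -> exists2 n, has_order x n & (n %| m)%N.
Proof.
move=> m0 xm.
have exn : exists n, (0 < n)%N && (x ^+ n == 1) by exists m; rewrite m0 xm eqxx.
case: (ex_minnP exn) => n /andP[n0 /eqP xn] minn; exists n.
  by split=> // i i0 xi; apply: minn; rewrite i0 xi eqxx.
have : x ^+ (m %% n) = 1.
  by move: xm; rewrite {1}(divn_eq m n) expgnDr mulnC expgnA xn expg1n mul1g.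
case: (posnP (m %% n)) => [/eqP //|r0 xr].
have := minn (m %% n)%N; rewrite r0 xr eqxx => /(_ isT).
by rewrite leqNgt ltn_pmod.
Qed.

Lemma zexp_abs x k : zexp x k = 1 -> x ^+ `|k|%N = 1.
Proof. by case: k => m //= /eqP; rewrite invg_eq1 => /eqP. Qed.

Lemma has_order_dvdz x n k :
  has_order x n -> zexp x k = 1 <-> (Posz n %| k)%Z.
Proof.
move=> [n0 xn minn]; split=> [xk|/dvdzP[q ->]]; last first.
  by rewrite GRing.mulrC zexpM /= xn zexp1n.
have xk' := zexp_abs xk.
case: (posnP `|k|%N) => [k0|k0]; first by rewrite (_ : k = 0%R) ?dvdz0 //; lia.
have [n' [n'0 xn' minn'] dv] := has_order_of_expg k0 xk'.
suff -> : n = n' by rewrite dvdzE.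
by apply/eqP; rewrite eqn_leq minn // minn'.
Qed.

Lemma has_order_dvdn x n m : has_order x n -> x ^+ m = 1 <-> (n %| m)%N.
Proof. by move=> hx; rewrite -(has_order_dvdz (Posz m) hx). Qed.

Lemma odd_order_of_expg x m : x ^+ m = 1 -> odd m -> odd_order x.
Proof.
move=> xm om; have m0 : (0 < m)%N by case: m om {xm}.
by have [n hn dv] := has_order_of_expg m0 xm; exists n => //; apply: dvdn_odd dv om.
Qed.

Lemma infinite_order_zexp x k : infinite_order x -> zexp x k = 1 -> k = 0%R.
Proof.
move=> xinf xk.
have xk' := zexp_abs xk.
case: (posnP `|k|%N) => [k0|k0]; first by lia.
by have [n hn _] := has_order_of_expg k0 xk'; case: xinf; exists n.
Qed.

Lemma cyclic_enum x n : has_order x n ->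
  exists s : seq G, [/\ uniq s, size s = n & forall y, y \in s <-> cyclic_subgroup x y].
Proof.
move=> hx; have [n0 xn minn] := hx.
exists [seq x ^+ i | i <- iota 0 n]; split.
- rewrite map_inj_in_uniq ?iota_uniq // => i j.
  rewrite !mem_iota !add0n /= => ilt jlt xij.
  have : (Posz n %| (Posz i - Posz j)%R)%Z.
    by apply/(has_order_dvdz _ hx); rewrite zexpD zexp_opp /= xij mulgV.
  case/dvdzP=> q; have [|[|]] : (q = 0 \/ q >= 1 \/ q <= -1)%R by lia.
  - by move=> ->; lia.
  - by nia.
  - by nia.
- by rewrite size_map size_iota.
move=> y; split=> [/mapP[i _ ->]|/cyclic_subgroupP[k ->]].
  by apply/cyclic_subgroupP; exists (Posz i).
have n0' : (Posz n != 0)%R by lia.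
have k0 := modz_ge0 k n0'; have kn := ltz_pmod k (_ : (0 < Posz n)%R).
apply/mapP; exists `|(k %% n)%Z|%N; first by rewrite mem_iota; lia.
rewrite {1}(divz_eq k n) zexpD GRing.mulrC zexpM /= xn zexp1n mul1g.
by rewrite -[in LHS](gez0_abs k0).
Qed.

(** A finite subgroup is given by the list of its elements, because the ambient group is infinite
in general; the list carries a finite group to which Lagrange's theorem applies. *)
Lemma expg_size (s : seq G) x :
  uniq s -> 1 \in s -> {in s &, forall y z, y * z \in s} ->
  {in s, forall y, y^-1 \in s} -> x \in s -> x ^+ size s = 1.
Proof.
move=> us s1 sM sV sx.
pose T := seq_sub s.
pose one : T := SeqSub s1.
pose mul (u v : T) : T := SeqSub (sM _ _ (ssvalP u) (ssvalP v)).
pose inv (u : T) : T := SeqSub (sV _ (ssvalP u)).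
have mulA : associative mul by move=> u v w; apply: val_inj; rewrite /= mulgA.
have mul1 : left_id one mul by move=> u; apply: val_inj; rewrite /= mul1g.
have mulV : left_inverse one inv mul by move=> u; apply: val_inj; rewrite /= mulVg.
pose gT : finGroupType := HB.pack T (Finite_isGroup.Build T mulA mul1 mulV).
pose u : gT := SeqSub sx.
have := @expg_cardG gT [set: gT]%G u; rewrite finset.in_setT => /(_ isT).
have uE n : val (u ^+ n : T) = x ^+ n.
  by elim: n => [|n IHn] //; rewrite !expgS /= -IHn.
rewrite finset.cardsT (card_seq_sub us : #|gT| = _) => /(congr1 (fun v : T => val v)).
by rewrite uE.
Qed.

End Powers.

Section Morphisms.
Local Open Scope group_scope.
Variables (G H : groupType) (f : G -> H).
Hypothesis fM : {morph f : x y / x * y}.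

Lemma morph_one : f 1 = 1.
Proof. by apply: (can_inj (mulgK (f 1))); rewrite -fM !mul1g. Qed.

Lemma morph_inv x : f x^-1 = (f x)^-1.
Proof. by apply: (can_inj (mulgK (f x))); rewrite -fM !mulVg morph_one. Qed.

Lemma morph_zexp x k : f (zexp x k) = zexp (f x) k.
Proof.
have pos n : f (x ^+ n) = f x ^+ n.
  by elim: n => [|n IHn]; rewrite ?expgS ?fM ?IHn //; exact: morph_one.
by case: k => n; rewrite /= ?morph_inv pos.
Qed.

End Morphisms.

Lemma normal_subgroup_cosetM (G : groupType) (N : set G) (x y x' y' : G) :
  normal_subgroup N -> N (x^-1 * x')%g -> N (y^-1 * y')%g ->
  N ((x * y)^-1 * (x' * y'))%g.
Proof.
move=> [[_ NM _] NJ] h1 h2; have := NM _ _ (NJ _ y h1) h2.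
by rewrite /conjg invgM !mulgA mulgK.
Qed.

Section GroupOrders.
Local Open Scope group_scope.

Lemma subgroup_expg_card (G : groupType) (H : set G) (s : seq G) x :
  uniq s -> (forall y, y \in s <-> H y) -> subgroup H -> H x -> x ^+ size s = 1.
Proof.
move=> us sH [H1 HM HV] Hx; apply: expg_size => //.
- exact/sH.
- by move=> y z /sH Hy /sH Hz; apply/sH; apply: HM.
- by move=> y /sH Hy; apply/sH; apply: HV.
- exact/sH.
Qed.

(** Finite cyclic subgroups of the two groups of a skew brace live in different groups on the same
carrier, so that their equality is obtained by counting elements. *)
Lemma enum_sub_eq (T : eqType) (X Y : set T) (s t : seq T) :
  uniq s -> size s = size t -> (forall y, y \in s <-> X y) ->
  (forall y, y \in t <-> Y y) -> X `<=` Y -> X = Y.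
Proof.
move=> us sst sX tY XY; apply/seteqP; split=> // y /tY yt.
have st : {subset s <= t} by move=> z /sX /XY /tY.
by apply/sX; have [_ ->] := uniq_min_size us st (eq_leq (esym sst)).
Qed.

Lemma has_order_unique (G : groupType) (x : G) m n :
  has_order x m -> has_order x n -> m = n.
Proof.
move=> [m0 xm minm] [n0 xn minn].
by apply/eqP; rewrite eqn_leq minm // minn.
Qed.

Lemma zexp_nat (G : groupType) (x : G) n k :
  (0 < n)%N -> x ^+ n = 1 -> exists m : nat, zexp x k = zexp x m.
Proof.
move=> n0 xn; have n0' : (Posz n != 0)%R by lia.
exists `|(k %% n)%Z|%N; rewrite (gez0_abs (modz_ge0 k n0')).
by rewrite {1}(divz_eq k n) zexpD GRing.mulrC zexpM /= xn zexp1n mul1g.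
Qed.

(** The number [k] divides the order of [x], where every [k] divides an infinite order: one notion
for the index of [<x ^+ k>] in [<x>], whether or not [x] has finite order. *)
Definition dvd_order (G : groupType) (x : G) (k : nat) :=
  forall i : int, zexp x i = 1 -> (Posz k %| i)%Z.

Lemma cyclic_zexp_dvd (G : groupType) (x : G) (k : nat) (i : int) :
  dvd_order x k -> cyclic_subgroup (zexp x k) (zexp x i) -> (Posz k %| i)%Z.
Proof.
move=> xk /cyclic_subgroupP[j]; rewrite -zexpM => xij.
have : zexp x (i - Posz k * j)%R = 1 by rewrite zexpD zexp_opp xij mulgV.
move=> /xk h; have -> : (i = (i - Posz k * j) + Posz k * j)%R by lia.
by rewrite GRing.rpredD ?dvdz_mulr.
Qed.

Lemma zexp_in_cyclic (G : groupType) (x : G) (k : nat) (i : int) :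
  (Posz k %| i)%Z -> cyclic_subgroup (zexp x k) (zexp x i).
Proof. by case/dvdzP=> j ->; rewrite GRing.mulrC zexpM; apply: cyclic_subgroup_zexp. Qed.

Lemma has_order_quotient (G Q : groupType) (f : G -> Q) (x : G) (k : nat) :
  {morph f : y z / y * z} -> (forall y, f y = 1 <-> cyclic_subgroup (zexp x k) y) ->
  (0 < k)%N -> dvd_order x k -> has_order (f x) k.
Proof.
move=> fM fK k0 xk.
have dv m : f x ^+ m = 1 <-> (k %| m)%N.
  rewrite -[f x ^+ m]/(zexp (f x) m) -(morph_zexp fM) fK -[(k %| m)%N]/(Posz k %| Posz m)%Z.
  by split; [apply: cyclic_zexp_dvd | apply: zexp_in_cyclic].
split=> //; first exact/dv.
by move=> m m0 /dv/dvdn_leq; apply.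
Qed.

Lemma has_order_dvd_order (G : groupType) (x : G) m k :
  has_order x m -> (k %| m)%N -> dvd_order x k.
Proof.
move=> hx km i /(has_order_dvdz _ hx); apply: dvdz_trans.
by rewrite dvdzE.
Qed.

Lemma has_order_expg (G : groupType) (x : G) m k :
  has_order x m -> (0 < k)%N -> (k %| m)%N -> has_order (zexp x k) (m %/ k).
Proof.
move=> hx k0 km; have [m0 xm _] := hx.
have dv i : zexp x k ^+ i = 1 <-> (m %/ k %| i)%N.
  rewrite -[_ ^+ i]/(zexp (zexp x k) (Posz i)) -zexpM -PoszM.
  by rewrite (has_order_dvdn _ hx) -{1}(divnK km) [(k * i)%N]mulnC (dvdn_pmul2r k0).
split; first by rewrite divn_gt0 // dvdn_leq.
- exact/dv.
by move=> i i0 /dv/dvdn_leq; apply.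
Qed.

Lemma infinite_dvd_order (G : groupType) (x : G) k :
  infinite_order x -> dvd_order x k.
Proof. by move=> hx i /(infinite_order_zexp hx) ->; rewrite dvdz0. Qed.

Lemma infinite_order_zexp_nat (G : groupType) (x : G) (k : nat) :
  infinite_order x -> (0 < k)%N -> infinite_order (zexp x k).
Proof.
move=> hx k0 [m [m0 xm _]]; have : zexp x (Posz k * Posz m)%R = 1%g by rewrite zexpM.
by move/(infinite_order_zexp hx); nia.
Qed.

End GroupOrders.

(** * Divisibility of geometric sums *)

Section Arithmetic.

Lemma dvdz_all_primes (k : int) : (forall p, prime p -> (Posz p %| k)%Z) -> k = 0%R.
Proof.
move=> h; have [p lt pr] := prime_above `|k|%N.
have := h p pr; rewrite dvdzE /=.
case: (posnP `|k|%N) => [|k0 /(dvdn_leq k0)]; lia.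
Qed.

(** The binomial expansion of [(1 + d t) ^ i] modulo [d ^ 2], summed over [i]. *)
Lemma geom_sum_binomial (d t k : nat) :
  exists w, \sum_(i < k) (d * t).+1 ^ i = k + 'C(k, 2) * (d * t) + d * d * w.
Proof.
elim: k => [|k [w IH]]; first by exists 0; rewrite big_ord0 bin0n /=; lia.
rewrite big_ord_recl expn0.
have -> : \sum_(i < k) (d * t).+1 ^ bump 0 i = (d * t).+1 * \sum_(i < k) (d * t).+1 ^ i.
  by rewrite big_distrr /=; apply: eq_bigr => i _; rewrite -expnS.
rewrite IH binS bin1; exists ((d * t).+1 * w + 'C(k, 2) * t * t); nia.
Qed.

Lemma geom_sum_mod (r m p : nat) :
  r = 1 %[mod p] -> \sum_(i < m) r ^ i = m %[mod p].
Proof.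
move=> r1; elim: m => [|m IHm]; first by rewrite big_ord0.
by rewrite big_ord_recr /= -modnDm IHm -modnXm r1 modnXm exp1n modnDm addn1.
Qed.

(** For a prime [p] dividing [n] the sum is [m] modulo [p], so [p] divides [m] and the sum factors as
the sum of [p] powers of [r] times the sum of [m / p] powers of [r ^ p]. As [p] is odd, the first
factor is [p (1 + p u)], where [1 + p u] is prime to [n]; cancelling [p] leaves the same
assertion for [n / p] and [m / p]. *)
Lemma dvdn_geom_sum (r n m : nat) :
  odd n -> (forall p, prime p -> (p %| n)%N -> r = 1 %[mod p]) ->
  (n %| \sum_(i < m) r ^ i)%N -> (n %| m)%N.
Proof.
have [N] := ubnP n; elim: N n r m => // N IHN n r m ltnN on r1 dvS.
have n0 : (0 < n)%N by case: n on {ltnN r1 dvS}.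
have [->|n1] : n = 1 \/ (1 < n)%N by lia.
  exact: dvd1n.
have [p pr pn] := pdivP n1; have p1 := prime_gt1 pr.
have op : odd p by exact: dvdn_odd pn on.
have pm : (p %| m)%N.
  by rewrite /dvdn -(geom_sum_mod m (r1 p pr pn)); exact: dvdn_trans pn dvS.
have [m' mE] := dvdnP pm; have [n' nE] := dvdnP pn.
have SE : \sum_(i < m) r ^ i = (\sum_(j < p) r ^ j) * \sum_(i < m') (r ^ p) ^ i.
  rewrite mE {mE pm dvS}; elim: m' => [|k IHk]; first by rewrite mul0n !big_ord0 muln0.
  rewrite mulSn addnC big_split_ord /= IHk [in RHS]big_ord_recr /= mulnDr; congr addn.
  by rewrite big_distrl /=; apply: eq_bigr => i _; rewrite expnD -expnM [(p * k)%N]mulnC mulnC.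
have [u uE] : exists u, \sum_(j < p) r ^ j = p * (1 + p * u).
  have := r1 p pr pn; rewrite (modn_small p1) => rp.
  have rE : r = (p * (r %/ p)).+1 by rewrite {1}(divn_eq r p) rp mulnC addn1.
  have [w] := geom_sum_binomial p (r %/ p) p; rewrite -rE => ->.
  have /dvdnP[c ->] : (p %| 'C(p, 2))%N by apply: prime_dvd_bin => //; lia.
  by exists (c * (r %/ p) + w); nia.
have cop q : prime q -> (q %| n)%N -> ~~ (q %| 1 + p * u)%N.
  move=> prq qn; apply/negP=> qu.
  have qS : (q %| \sum_(j < p) r ^ j)%N by rewrite uE dvdn_mull.
  have qp : (q %| p)%N by rewrite /dvdn -(geom_sum_mod p (r1 q prq qn)).
  have /eqP qpe : q == p by rewrite -(dvdn_prime2 prq pr).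
  by move: qu; rewrite qpe addnC dvdn_addr ?dvdn_mulr // dvdn1 => /eqP; lia.
have copn : coprime n (1 + p * u).
  rewrite /coprime; apply: contraT => g1.
  have [|q prq] := @pdivP (gcdn n (1 + p * u)).
    by rewrite ltn_neqAle eq_sym g1 gcdn_gt0 n0.
  by rewrite dvdn_gcd => /andP[qn qu]; have := cop q prq qn; rewrite qu.
have p0 := prime_gt0 pr.
have dv' : (n' %| \sum_(i < m') (r ^ p) ^ i)%N.
  have copn' : coprime n' (1 + p * u) by apply: coprime_dvdl copn; rewrite nE dvdn_mulr.
  rewrite -(Gauss_dvdr _ copn') -(dvdn_pmul2r p0) -nE.
  by move: dvS; rewrite SE uE; congr (_ %| _)%N; lia.
rewrite mE nE dvdn_pmul2r //; apply: (IHN n' (r ^ p)) => //.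
- by nia.
- by move: on; rewrite nE oddM => /andP[].
move=> q prq qn'; have := r1 q prq; rewrite nE dvdn_mulr // => /(_ isT) rq.
by rewrite -modnXm rq modnXm exp1n.
Qed.

End Arithmetic.

Local Open Scope skew_brace_scope.

(** * The maps lambda and the cosets of an ideal *)

Section Basics.
Variable B : skewBraceType.
Implicit Types (a b c x y : B) (k l : int) (I N : set B).

Definition addz b k : B := @zexp (addgroup B) b k.
Definition circz b k : B := @zexp B b k.

Lemma sbaddK a b : - a + (a + b) = b.
Proof. exact: (@mulKg (addgroup B)). Qed.

Lemma sbaddVK a b : a + (- a + b) = b.
Proof. exact: (@mulVKg (addgroup B)). Qed.

Lemma sbaddI a : injective (sbadd a).
Proof. exact: can_inj (sbaddK a). Qed.

Lemma sbone0 : (1%g : B) = 0.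
Proof.
have := sbmul_add (1%g : B) 0 0; rewrite !mul1g !sbadd0 sbaddr0 => h.
by rewrite -[LHS]sbaddr0 [X in _ + X]h sbaddrN.
Qed.

Lemma circ_lambda a b : a ∘ b = a + lambda a b.
Proof. by rewrite /lambda sbaddVK. Qed.

Lemma lambdaD a b c : lambda a (b + c) = lambda a b + lambda a c.
Proof. by rewrite /lambda sbmul_add -!sbaddA. Qed.

Lemma lambda_circ a b c : lambda (a ∘ b) c = lambda a (lambda b c).
Proof.
apply: (@sbaddI (a ∘ b)); rewrite -circ_lambda -mulgA (circ_lambda b).
by rewrite 2!(circ_lambda a) lambdaD sbaddA.
Qed.

Lemma lambda1 a : lambda 1%g a = a.
Proof. by apply: (@sbaddI 1%g); rewrite -circ_lambda mul1g sbone0 sbadd0. Qed.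

Lemma lambda0 a : lambda 0 a = a.
Proof. by rewrite -sbone0 lambda1. Qed.

Lemma lambdaK a : cancel (lambda a) (lambda a^-1%g).
Proof. by move=> b; rewrite -lambda_circ mulVg lambda1. Qed.

Lemma lambdaVK a : cancel (lambda a^-1%g) (lambda a).
Proof. by move=> b; rewrite -lambda_circ mulgV lambda1. Qed.

Lemma lambda_zexp a b k : lambda a (addz b k) = addz (lambda a b) k.
Proof. exact: (@morph_zexp (addgroup B) (addgroup B) _ (lambdaD a)). Qed.

Lemma lambda_r0 a : lambda a 0 = 0.
Proof. exact: (@morph_one (addgroup B) (addgroup B) _ (lambdaD a)). Qed.

Lemma circ_inv a : (a^-1)%g = - lambda a^-1%g a.
Proof.
apply: (@sbaddI (lambda a^-1%g a)); rewrite sbaddrN.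
apply: (can_inj (@lambdaK a)); rewrite lambdaD lambdaVK lambda_r0.
by rewrite -circ_lambda mulgV sbone0.
Qed.

(** A difference taken in one group is the [lambda]-image of the same difference taken
    in the other: an ideal has the same cosets in both groups. *)
Lemma ideal_coset N x y : ideal N -> N (- x + y) <-> N (x^-1 ∘ y)%g.
Proof.
move=> [_ HL _]; have e : lambda x (x^-1 ∘ y)%g = - x + y by rewrite /lambda mulVKg.
split=> h; last by rewrite -e; apply: HL.
by rewrite -[(_ ∘ y)](lambdaK x) e; apply: HL.
Qed.

(** The identities [a ∘ b = a + lambda a b] and [a^-1 = - lambda a^-1 a] express the multiplicative
operations through the additive ones and [lambda]. *)
Lemma lambda_closed_subgroup (H : set B) :
  @subgroup (addgroup B) H -> (forall a x, H a -> H x -> H (lambda a x)) ->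
  (forall a x, H a -> H x -> H (lambda a^-1%g x)) -> @subgroup B H.
Proof.
move=> [H0 HD HN] HL HLV; split=> [|x y Hx Hy|x Hx].
- by rewrite sbone0.
- by rewrite circ_lambda; apply: HD => //; apply: HL.
- by rewrite circ_inv; apply: HN; apply: HLV.
Qed.

End Basics.

(** * The quotient of a skew brace by an ideal *)

Section Quotient.
Local Open Scope quotient_scope.
Variables (B : skewBraceType) (N : set B).
Hypothesis idN : ideal N.

Definition coset_rel (x y : B) : bool := `[< N (x^-1 ∘ y)%g >].

Lemma coset_rel_refl : reflexive coset_rel.
Proof. by move=> x; apply/asboolP; rewrite mulVg; case: idN => _ _ [[]]. Qed.

Lemma coset_rel_sym : symmetric coset_rel.
Proof.
have [_ _ [[_ _ NV] _]] := idN.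
suff h x y : coset_rel x y -> coset_rel y x by move=> x y; apply/idP/idP; apply: h.
by move=> /asboolP /NV h; apply/asboolP; rewrite invgM invgK in h.
Qed.

Lemma coset_rel_trans : transitive coset_rel.
Proof.
have [_ _ [[_ NM _] _]] := idN.
move=> y x z /asboolP h1 /asboolP h2; apply/asboolP.
by have := NM _ _ h1 h2; rewrite -mulgA mulVKg.
Qed.

Canonical coset_equiv := EquivRel coset_rel coset_rel_refl coset_rel_sym coset_rel_trans.

Definition brace_quot := {eq_quot coset_equiv}.
HB.instance Definition _ := Choice.on brace_quot.
HB.instance Definition _ := EqQuotient.on brace_quot.

Definition proj (x : B) : brace_quot := \pi x.

Lemma projP x y : proj x = proj y <-> N (x^-1 ∘ y)%g.
Proof.
split=> [/eqP|h]; first by rewrite eqmodE => /asboolP.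
by apply/eqP; rewrite eqmodE; apply/asboolP.
Qed.

Lemma projDP x y : proj x = proj y <-> N (- x + y).
Proof. by rewrite projP (ideal_coset _ _ idN). Qed.

Lemma proj_repr (u : brace_quot) : proj (repr u) = u.
Proof. exact: reprK. Qed.

Lemma proj_circ x y x' y' : proj x = proj x' -> proj y = proj y' ->
  proj (x ∘ y) = proj (x' ∘ y').
Proof.
move=> /projP h1 /projP h2; apply/projP; have [_ _ nN] := idN.
exact: normal_subgroup_cosetM.
Qed.

Lemma proj_add x y x' y' : proj x = proj x' -> proj y = proj y' ->
  proj (x + y) = proj (x' + y').
Proof.
move=> /projDP h1 /projDP h2; apply/projDP; have [nN _ _] := idN.
exact: (@normal_subgroup_cosetM (addgroup B)).
Qed.

Definition qmul (u v : brace_quot) := proj (repr u ∘ repr v).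
Definition qinv (u : brace_quot) := proj (repr u)^-1%g.
Definition qadd (u v : brace_quot) := proj (repr u + repr v).
Definition qopp (u : brace_quot) := proj (- repr u).

Lemma qmulE x y : qmul (proj x) (proj y) = proj (x ∘ y).
Proof. by apply: proj_circ; rewrite proj_repr. Qed.

Lemma qaddE x y : qadd (proj x) (proj y) = proj (x + y).
Proof. by apply: proj_add; rewrite proj_repr. Qed.

Lemma qmulA : associative qmul.
Proof.
move=> u v w; rewrite -(proj_repr u) -(proj_repr v) -(proj_repr w).
by rewrite !qmulE mulgA.
Qed.

Lemma qmul1 : left_id (proj 1%g) qmul.
Proof. by move=> u; rewrite -(proj_repr u) qmulE mul1g. Qed.

Lemma qmulr1 : right_id (proj 1%g) qmul.
Proof. by move=> u; rewrite -(proj_repr u) qmulE mulg1. Qed.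

Lemma qmulV : left_inverse (proj 1%g) qinv qmul.
Proof. by move=> u; rewrite -{2}(proj_repr u) qmulE mulVg. Qed.

Lemma qmulrV : right_inverse (proj 1%g) qinv qmul.
Proof. by move=> u; rewrite -{1}(proj_repr u) qmulE mulgV. Qed.

HB.instance Definition _ := isGroup.Build brace_quot qmulA qmul1 qmulr1 qmulV qmulrV.

Lemma qaddA : associative qadd.
Proof.
move=> u v w; rewrite -(proj_repr u) -(proj_repr v) -(proj_repr w).
by rewrite !qaddE sbaddA.
Qed.

Lemma qadd0 : left_id (proj 0) qadd.
Proof. by move=> u; rewrite -(proj_repr u) qaddE sbadd0. Qed.

Lemma qaddN : left_inverse (proj 0) qopp qadd.
Proof. by move=> u; rewrite -{2}(proj_repr u) qaddE sbaddN. Qed.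

Lemma qmul_add u v w : (u * qadd v w)%g = qadd (qadd (u * v)%g (qopp u)) (u * w)%g.
Proof.
rewrite -(proj_repr u) -(proj_repr v) -(proj_repr w); set x := repr u.
have eN : qopp (proj x) = proj (- x).
  rewrite -[RHS]qadd0 -(qaddN (proj x)) -qaddA qaddE sbaddrN.
  by rewrite -(proj_repr (qopp _)) qaddE sbaddr0.
by rewrite eN !(qaddE, qmulE : forall x y, (proj x * proj y)%g = _) sbmul_add.
Qed.

HB.instance Definition _ := isSkewBrace.Build brace_quot qaddA qadd0 qaddN qmul_add.

End Quotient.

Section QuotientMap.
Variables (B : skewBraceType) (N : set B).

(** The quotient is only used through this universal data: it allows every computation modulo an
ideal to be carried out with equalities. *)
Lemma ideal_quotient : ideal N ->
  exists (Q : skewBraceType) (pi : B -> Q),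
    [/\ {morph pi : x y / x ∘ y}, {morph pi : x y / x + y}
      & forall x, pi x = 0 <-> N x].
Proof.
move=> idN; exists (brace_quot idN : skewBraceType), (proj idN).
split=> [x y|x y|x]; first by rewrite -qmulE.
- by rewrite -qaddE.
have -> : (0 : brace_quot idN) = proj idN 0 by [].
split=> [h|h]; [move/esym/projDP: h|apply/esym/projDP].
  by rewrite -[- 0]sbaddr0 sbaddN sbadd0.
by rewrite -[- 0]sbaddr0 sbaddN sbadd0.
Qed.

End QuotientMap.

(** * Comparing the additive and the multiplicative powers of one element *)

Section AddPowers.
Variable B : skewBraceType.
Implicit Types (b x : B) (k l : int).

Lemma addzD b k l : addz b (k + l)%R = addz b k + addz b l.
Proof. exact: (@zexpD (addgroup B)). Qed.

Lemma addzM b k l : addz b (k * l)%R = addz (addz b k) l.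
Proof. exact: (@zexpM (addgroup B)). Qed.

Lemma addz1 b : addz b 1 = b.
Proof. exact: (@expg1 (addgroup B)). Qed.

Lemma addz0l k : addz (0 : B) k = 0.
Proof. exact: (@zexp1n (addgroup B)). Qed.

Lemma cyclic_addP b x : cyclic_add b x <-> exists k, x = addz b k.
Proof. exact: (@cyclic_subgroupP (addgroup B)). Qed.

Lemma cyclic_circP b x : cyclic_circ b x <-> exists k, x = circz b k.
Proof. exact: (@cyclic_subgroupP B). Qed.

Lemma addz_congr b (p : nat) k l :
  addz b p = 0 -> (Posz p %| (k - l)%R)%Z -> addz b k = addz b l.
Proof.
move=> bp /dvdzP[q kl]; have -> : (k = Posz p * q + l)%R by lia.
by rewrite addzD addzM bp addz0l sbadd0.
Qed.

Lemma addz_prime_order b (p : nat) k :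
  prime p -> b <> 0 -> addz b p = 0 -> addz b k = 0 -> (Posz p %| k)%Z.
Proof.
move=> pr bn0 bp bk; apply: contraT => npk.
have /coprimezP[[u v] /= uv] : coprimez p k.
  by rewrite coprimezE prime_coprime // -dvdzE.
case: bn0; rewrite -(addz1 b) -uv addzD ![(_ * Posz p)%R]GRing.mulrC [(v * _)%R]GRing.mulrC.
by rewrite !addzM bp bk !addz0l sbadd0.
Qed.

(** Otherwise [1 - j] is invertible modulo [p], and the map [x |-> b ∘ x], which sends [t b] to
    [(1 + t j) b], has a fixed point; but a translation with a fixed point is trivial. *)
Lemma lambda_prime_order b (p : nat) (j : int) :
  prime p -> b <> 0 -> addz b p = 0 -> lambda b b = addz b j ->
  (Posz p %| (j - 1)%R)%Z.
Proof.
move=> pr bn0 bp bj; apply: contraT => npj.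
have /coprimezP[[t w] /= tw] : coprimez (j - 1)%R p.
  by rewrite coprimez_sym coprimezE prime_coprime // -dvdzE.
(* the fixed point is [x = (- t) b], for the Bezout relation [t (j - 1) + w p = 1] *)
case: bn0; rewrite -sbone0; apply: (can_inj (mulgK (addz b (- t)%R))); rewrite mul1g.
rewrite circ_lambda lambda_zexp bj -addzM -{1}(addz1 b) -addzD.
apply: (addz_congr bp); apply/dvdzP; exists w; lia.
Qed.

(** The stabiliser of [b] under [lambda] is a multiplicative subgroup containing [b], so multiplying
by [b] on the right always adds [b]. *)
Lemma circz_lambda_fixed b k : lambda b b = b -> circz b k = addz b k.
Proof.
move=> bb; have Hb n : lambda (circz b n) b = b.
  have -> // : cyclic_circ b `<=` [set a | lambda a b = b].
    apply: cyclic_subgroup_sub => //; split=> [|x y hx hy|x hx] /=.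
    - exact: lambda1.
    - by rewrite lambda_circ hy hx.
    - by rewrite -{1}hx lambdaK.
  by apply/cyclic_circP; exists n.
have S n : circz b (n + 1)%R = circz b n + b.
  by rewrite /circz zexp_succ circ_lambda Hb.
elim/int_rect: k => [|n IHn|n IHn]; first exact: sbone0.
- by rewrite -addn1 PoszD S IHn addzD addz1.
apply: (can_inj (fun x => (@mulgK (addgroup B) b x))).
have -> : (- Posz n.+1 = - Posz n - 1)%R by lia.
change (circz b (- Posz n - 1)%R + b = addz b (- Posz n - 1)%R + b).
by rewrite -S -{3}(addz1 b) -addzD !GRing.subrK.
Qed.

(** Lagrange's theorem in the additive group carried by the multiplicative cyclic group of [b]. *)
Lemma add_order_dvd_circ b (k : nat) : has_order (G := B) b k ->
  @subgroup (addgroup B) (cyclic_circ b) -> addz b k = 0.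
Proof.
move=> hb sb; have [s [us <- sE]] := cyclic_enum hb.
exact: (@subgroup_expg_card (addgroup B) _ s b us sE sb (@cyclic_subgroup_id B b)).
Qed.

(** Lagrange's theorem in the multiplicative group carried by the additive cyclic group of [b]. *)
Lemma circ_order_dvd_add b (k : nat) : @has_order (addgroup B) b k ->
  @subgroup B (cyclic_add b) -> circz b k = 1%g.
Proof.
move=> hb sb; have [s [us <- sE]] := cyclic_enum hb.
apply: (@subgroup_expg_card B _ s b us sE sb).
exact: (@cyclic_subgroup_id (addgroup B)).
Qed.

Lemma equal_orders_add_sub_circ b (k : nat) :
  @has_order (addgroup B) b k -> @has_order B b k ->
  cyclic_add b `<=` cyclic_circ b -> cyclic_add b = cyclic_circ b.
Proof.
move=> ha hc; have [s [us sk sE]] := cyclic_enum ha; have [t [_ tk tE]] := cyclic_enum hc.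
by apply: (@enum_sub_eq B _ _ s t) => //; rewrite sk tk.
Qed.

Lemma equal_orders_circ_sub_add b (k : nat) :
  @has_order (addgroup B) b k -> @has_order B b k ->
  cyclic_circ b `<=` cyclic_add b -> cyclic_circ b = cyclic_add b.
Proof.
move=> ha hc; have [s [us sk sE]] := cyclic_enum hc; have [t [_ tk tE]] := cyclic_enum ha.
by apply: (@enum_sub_eq B _ _ s t) => //; rewrite sk tk.
Qed.

(** The additive group on [<b>] has prime order, hence is generated by [b] as well, so that
[lambda b b] is a multiple of [b] and the fixed point argument applies. *)
Lemma circ_prime_order_lambda b (p : nat) : prime p ->
  @has_order B b p -> @subgroup (addgroup B) (cyclic_circ b) -> lambda b b = b.
Proof.
move=> pr hb sb; have bp := add_order_dvd_circ hb sb.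
have p1 := prime_gt1 pr.
have bn0 : b <> 0.
  move=> b0; have [_ _ /(_ 1%N isT)] := hb.
  by rewrite expg1 b0 -sbone0 => /(_ erefl); lia.
have ha : @has_order (addgroup B) b p.
  split; [lia | exact: bp | move=> m m0 bm].
  by have := addz_prime_order (k := Posz m) pr bn0 bp bm; apply: dvdn_leq.
have sub : cyclic_add b `<=` cyclic_circ b.
  by apply: (@cyclic_subgroup_sub (addgroup B)) => //; exact: cyclic_subgroup_id.
have [j bj] : exists j, lambda b b = addz b j.
  apply/cyclic_addP; rewrite (equal_orders_add_sub_circ ha hb sub).
  have [_ sD sN] := sb; have cb := @cyclic_subgroup_id B b.
  apply: sD; first exact: sN.
  by have [_ + _] := cyclic_subgroup_subgroup b; apply.
by rewrite bj -[RHS]addz1; apply: (addz_congr bp); apply: lambda_prime_order bj.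
Qed.

End AddPowers.

Section BraceMorphisms.
Variables (B Q : skewBraceType) (f : B -> Q).
Hypothesis fM : {morph f : x y / x ∘ y}.
Hypothesis fD : {morph f : x y / x + y}.

Lemma morph_addz b k : f (addz b k) = addz (f b) k.
Proof. exact: (@morph_zexp (addgroup B) (addgroup Q) f fD). Qed.

Lemma morph_opp b : f (- b) = - f b.
Proof. exact: (@morph_inv (addgroup B) (addgroup Q) f fD). Qed.

Lemma morph_circz b k : f (circz b k) = circz (f b) k.
Proof. exact: (@morph_zexp B Q f fM). Qed.

Lemma morph_lambda a b : f (lambda a b) = lambda (f a) (f b).
Proof. by rewrite /lambda fD fM morph_opp. Qed.

Lemma morph_cyclic_circ_subgroup b :
  @subgroup (addgroup B) (cyclic_circ b) -> @subgroup (addgroup Q) (cyclic_circ (f b)).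
Proof.
move=> [s0 sD sN]; have cf y : cyclic_circ b y -> cyclic_circ (f b) (f y).
  by move=> /cyclic_circP[k ->]; apply/cyclic_circP; exists k; rewrite morph_circz.
have lift y : cyclic_circ (f b) y -> exists2 z, cyclic_circ b z & y = f z.
  move=> /cyclic_circP[k ->]; exists (circz b k); last by rewrite morph_circz.
  by apply/cyclic_circP; exists k.
split=> [|y z /lift[y' hy ->] /lift[z' hz ->]|y /lift[y' hy ->]].
- have -> : (1%g : addgroup Q) = f 0 by rewrite (@morph_one (addgroup B) (addgroup Q) f fD).
  exact: cf.
- by have : cyclic_circ (f b) (f (y' + z')) := cf _ (sD _ _ hy hz); rewrite fD.
- by have : cyclic_circ (f b) (f (- y')) := cf _ (sN _ hy); rewrite morph_opp.
Qed.

End BraceMorphisms.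

(** * Cyclic subgroups that are ideals *)

Section IdealPowers.
Variable B : skewBraceType.
Implicit Types (a b x y : B).

Lemma ideal_add_subgroup (I : set B) : ideal I -> @subgroup (addgroup B) I.
Proof. by case=> [[]]. Qed.

Lemma ideal_circ_subgroup (I : set B) : ideal I -> @subgroup B I.
Proof. by case=> _ _ []. Qed.

(** Lagrange's theorem in the quotient of [<b>] by its subgroup of index [k]. *)
Lemma circ_index_addz b (k : nat) : (0 < k)%N -> dvd_order (G := B) b k ->
  @subgroup (addgroup B) (cyclic_circ b) -> ideal (cyclic_circ (circz b k)) ->
  cyclic_circ (circz b k) (addz b k).
Proof.
move=> k0 bk sb /ideal_quotient[Q [f [fM fD fK]]].
apply/fK; rewrite (morph_addz fD); apply: add_order_dvd_circ.
  by apply: has_order_quotient => // y; rewrite sbone0; exact: fK.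
exact: morph_cyclic_circ_subgroup.
Qed.

Lemma circ_prime_index_lambda b (p : nat) : prime p -> dvd_order (G := B) b p ->
  @subgroup (addgroup B) (cyclic_circ b) -> ideal (cyclic_circ (circz b p)) ->
  forall (Q : skewBraceType) (f : B -> Q),
    {morph f : x y / x ∘ y} -> {morph f : x y / x + y} ->
    (forall x, f x = 0 <-> cyclic_circ (circz b p) x) ->
    lambda (f b) (f b) = f b.
Proof.
move=> pr bp sb ip Q f fM fD fK; apply: (circ_prime_order_lambda pr).
  by apply: has_order_quotient => // [y|]; [rewrite sbone0; exact: fK | exact: prime_gt0].
exact: morph_cyclic_circ_subgroup.
Qed.

(** An additive endomorphism of a cyclic group is a multiplication; as a consequence every
additive subgroup of a cyclic ideal is stable under [lambda]. *)
Lemma lambda_cyclic_add b a : ideal (cyclic_add b) ->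
  exists r, forall x, cyclic_add b x -> lambda a x = addz x r.
Proof.
move=> [_ HL _]; have /cyclic_addP[r br] := HL a b (@cyclic_subgroup_id (addgroup B) b).
exists r => _ /cyclic_addP[k ->]; rewrite lambda_zexp br.
exact: (@zexpAC (addgroup B)).
Qed.

Lemma cyclic_circ_sub_add b x : ideal (cyclic_add b) -> cyclic_add b x ->
  cyclic_circ x `<=` cyclic_add x.
Proof.
move=> ib bx; have sx := @cyclic_subgroup_subgroup (addgroup B) x.
have HL a y : cyclic_add x y -> cyclic_add x (lambda a y).
  move=> /cyclic_addP[k ->]; have [r ->] := lambda_cyclic_add a ib.
    by apply/cyclic_addP; exists (k * r)%R; rewrite addzM.
  exact: (subgroup_zexp _ (ideal_add_subgroup ib)).
apply: cyclic_subgroup_sub; last exact: (@cyclic_subgroup_id (addgroup B)).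
by apply: lambda_closed_subgroup => // a y _; apply: HL.
Qed.

(** Whichever of the two cyclic subgroups of [x] is an ideal, it contains
    the other one. *)
Lemma cyclic_add_ideal b x : ideal (cyclic_add b) -> cyclic_add b x ->
  ideal (cyclic_circ x) \/ ideal (cyclic_add x) -> ideal (cyclic_add x).
Proof.
move=> ib bx [ix|//]; suff <- : cyclic_circ x = cyclic_add x by [].
apply/seteqP; split; first exact: cyclic_circ_sub_add ib bx.
apply: (@cyclic_subgroup_sub (addgroup B)); first exact: ideal_add_subgroup.
exact: (@cyclic_subgroup_id B).
Qed.

(** Pass to the quotient by [<p b>], where [b] has additive order [p]. *)
Lemma prime_multiple_ideal_lambda b (p : nat) r : prime p -> lambda b b = addz b r ->
  ideal (cyclic_add (addz b p)) -> ~ cyclic_add (addz b p) b -> (Posz p %| (r - 1)%R)%Z.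
Proof.
move=> pr br /ideal_quotient[Q [f [fM fD fK]]] nb.
apply: (@lambda_prime_order _ (f b)) => //.
- by move/fK.
- by rewrite -(morph_addz fD); apply/fK; exact: (@cyclic_subgroup_id (addgroup B)).
by rewrite -(morph_lambda fM fD) br (morph_addz fD).
Qed.

Lemma not_cyclic_add_multiple b (p : nat) : prime p ->
  dvd_order (G := addgroup B) b p -> ~ cyclic_add (addz b p) b.
Proof.
move=> pr bp; rewrite -{2}(addz1 b) => /(@cyclic_zexp_dvd (addgroup B) b p 1 bp).
by rewrite dvdzE /= dvdn1 => /eqP p1; have := prime_gt1 pr; rewrite p1.
Qed.

Lemma lambda_fixed_cyclic_eq b : lambda b b = b -> cyclic_add b = cyclic_circ b.
Proof.
move=> bb; apply/seteqP; split=> x.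
  by move=> /cyclic_addP[k ->]; apply/cyclic_circP; exists k; rewrite circz_lambda_fixed.
by move=> /cyclic_circP[k ->]; apply/cyclic_addP; exists k; rewrite circz_lambda_fixed.
Qed.

(** Iterating [b ∘ x = b + lambda b x], where [lambda b] multiplies by [r]. *)
Lemma circz_geom_sum b (r m : nat) :
  lambda b b = addz b r -> circz b m = addz b (Posz (\sum_(i < m) r ^ i)).
Proof.
move=> br; elim: m => [|m IHm]; first by rewrite big_ord0; exact: sbone0.
have -> : circz b m.+1 = b ∘ circz b m by rewrite /circz /= expgS.
rewrite circ_lambda IHm lambda_zexp br -addzM -{1}(addz1 b) -addzD -PoszM -PoszD.
rewrite big_ord_recl expn0 big_distrr /=; congr (addz b (Posz (_ + _))).
by apply: eq_bigr => i _; rewrite -expnS.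
Qed.

Lemma finite_add_order_lambda b n : ideal (cyclic_add b) ->
  has_order (G := addgroup B) b n -> exists r : nat, lambda b b = addz b r.
Proof.
move=> ib [n0 bn _]; have [r br] := lambda_cyclic_add b ib.
rewrite (br _ (@cyclic_subgroup_id (addgroup B) b)).
exact: (@zexp_nat (addgroup B) b n).
Qed.

Lemma add_ideal_circ_expg b n : ideal (cyclic_add b) ->
  has_order (G := addgroup B) b n -> circz b n = 1%g.
Proof. by move=> ib hb; apply: (circ_order_dvd_add hb); apply: ideal_circ_subgroup. Qed.

(** If [b] has even additive order then [lambda b], being invertible, multiplies by an odd number
[r], and a geometric sum of [m] powers of [r] has the parity of [m]. *)
Lemma add_ideal_even_circ b n m : ideal (cyclic_add b) ->
  has_order (G := addgroup B) b n -> ~~ odd n -> circz b (Posz m) = 1%g -> ~~ odd m.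
Proof.
move=> ib hb en bm; have [r br] := finite_add_order_lambda ib hb.
have [n0 bn minn] := hb.
have or : odd r.
  apply: contraT => er.
  have nE := even_halfK en; have rE := even_halfK er.
  have h : addz b (n./2) = 0.
    apply: (can_inj (@lambdaK B b)); rewrite lambda_r0 lambda_zexp br -addzM.
    have -> : (Posz r * Posz n./2 = Posz n * Posz r./2)%R.
      by rewrite -!PoszM -{1}rE -{2}nE; congr Posz; lia.
    by rewrite addzM [addz b n]bn addz0l.
  by have := minn _ _ h; rewrite leqNgt; lia.
have : (n %| \sum_(i < m) r ^ i)%N.
  by apply/(has_order_dvdn _ hb); move: bm; rewrite (circz_geom_sum _ br) sbone0.
move=> dv; have : (2 %| \sum_(i < m) r ^ i)%N by apply: dvdn_trans dv; rewrite dvdn2.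
have r1 : r = 1 %[mod 2] by rewrite modn2 or.
by rewrite /dvdn (geom_sum_mod m r1) modn2 eqb0.
Qed.

(** The difference [lambda a x - x] lies in [I] because [I] is stable under [lambda]; moving [x]
to the left of [a] by a multiplicative conjugation shows that it also lies in [J]. *)
Lemma disjoint_ideals_lambda (I J : set B) a x : ideal I -> ideal J ->
  (forall y, I y -> J y -> y = 0) -> J a -> I x -> lambda a x = x.
Proof.
move=> [[[_ ID IN] _] IL _] [[[_ JD JN] JC] JL [[_ JM JV] JJ]] IJ Ja Ix.
have h : lambda a x + - x = 0.
  apply: IJ.
    by apply: ID; [apply: IL | apply: IN].
  have -> : lambda a x + - x = - a + (x + lambda x (x^-1 ∘ (a ∘ x))%g + - x).
    by rewrite -circ_lambda mulVKg /lambda sbaddA.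
  apply: JD; first exact: JN.
  have := JC _ (- x) (JL x _ (JJ a x Ja)).
  set v := lambda x _; rewrite /conjg.
  change (J (- - x + (v + - x)) -> J (x + v + - x)).
  have -> : - - x = x by exact: (@invgK (addgroup B)).
  by rewrite sbaddA.
by rewrite -[LHS]sbaddr0 -(sbaddN x) sbaddA h sbadd0.
Qed.

End IdealPowers.

(** * Multiplicatively cyclic ideals of odd order *)

Section Unipotent.
Variable Q : skewBraceType.
Implicit Types (b c : Q).

(** By Fermat's little theorem an endomorphism of a group of order [p] whose [p]-th power is trivial
is itself trivial. *)
Lemma addz_prime_power_fixed c (p s : nat) : prime p -> c <> 0 -> addz c p = 0 ->
  addz c (Posz (s ^ p)) = c -> addz c s = c.
Proof.
move=> pr cn0 cp cs; rewrite -[RHS]cs; apply: (addz_congr cp).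
by rewrite -eqz_mod_dvd !modz_nat fermat_little.
Qed.

Lemma iter_addz c (h : Q -> Q) (s : nat) : {morph h : x y / x + y} ->
  h c = addz c s -> forall n, iter n h c = addz c (Posz (s ^ n)).
Proof.
move=> hD hc; elim=> [|n IHn]; first exact/esym/addz1.
rewrite iterS IHn -[h _]/(h (addz c (s ^ n)%N)).
rewrite (@morph_zexp (addgroup Q) (addgroup Q) h hD).
change (addz (h c) (s ^ n)%N = addz c (s ^ n.+1)%N).
by rewrite hc -addzM -PoszM expnS.
Qed.

Lemma addz_nat c (p : nat) k : (0 < p)%N -> addz c p = 0 ->
  exists m : nat, addz c k = addz c m.
Proof. exact: (@zexp_nat (addgroup Q)). Qed.

Lemma conj_add b : {morph (fun x => - b + x + b) : x y / x + y}.
Proof. by move=> x y /=; rewrite -!sbaddA sbaddVK. Qed.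

Lemma iter_conj_addz b c n :
  iter n (fun x => - b + x + b) c = - addz b (Posz n) + c + addz b (Posz n).
Proof.
elim: n => [|n IHn]; first by rewrite /= -[- _]sbaddr0 sbaddN sbadd0 sbaddr0.
rewrite iterS IHn -addn1 PoszD addzD addz1.
have -> : - (addz b n + b) = - b + - addz b n by exact: (@invgM (addgroup Q)).
by rewrite !sbaddA.
Qed.

Lemma iter_lambda b c n : iter n (lambda b) c = lambda (circz b (Posz n)) c.
Proof.
elim: n => [|n IHn]; first by rewrite lambda1.
by rewrite iterS IHn -lambda_circ /circz /= expgS.
Qed.

(** This excludes a skew brace of order [p ^ 2], with [p] odd, whose multiplicative group is generated
by [b] while [p b = 0]. Both [lambda b] and the additive conjugation by [b] act on the multiples of
[c] with trivial [p]-th power, hence trivially; so with [d = - b + lambda b b] the power [b ^ n] is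
[n b + C(n, 2) d], which vanishes for [n = p]. *)
Lemma no_unipotent b (p : nat) (j r s : int) : prime p -> odd p ->
  let c := circz b p in
  c <> 0 -> addz c p = 0 -> addz b p = 0 -> lambda c c = c ->
  lambda b b = b + addz c j -> lambda b c = addz c r -> - b + c + b = addz c s -> False.
Proof.
move=> pr op c cn0 cp bp cc bb bc cb; have p0 := prime_gt0 pr.
have {r bc} bc : lambda b c = c.
  have [r' rE] := addz_nat r p0 cp; rewrite rE in bc; rewrite bc.
  apply: (addz_prime_power_fixed pr cn0 cp).
  by rewrite -(iter_addz (@lambdaD Q b) bc) iter_lambda.
have {s cb} cb : - b + c + b = c.
  have [s' sE] := addz_nat s p0 cp; rewrite sE in cb; rewrite cb.
  apply: (addz_prime_power_fixed pr cn0 cp).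
  rewrite -(iter_addz (@conj_add b) cb) iter_conj_addz bp sbaddr0.
  by rewrite -[- _]sbaddr0 sbaddN sbadd0.
have [d dE] : exists d, d = addz c j by exists (addz c j).
rewrite -dE in bb.
have bd : lambda b d = d by rewrite dE lambda_zexp bc.
have com : @commute (addgroup Q) b d.
  have cbE : @commute (addgroup Q) b c.
    by change (b + c = c + b); rewrite -{1}cb -sbaddA sbaddVK.
  have pos (n : nat) : @commute (addgroup Q) b (addz c n) by exact: commuteX.
  have [m mE] := addz_nat j p0 cp; rewrite dE mE; exact: pos.
have F (n : nat) : circz b n = addz b n + addz d 'C(n, 2).
  elim: n => [|n IHn]; first by rewrite sbaddr0; exact: sbone0.
  have -> : circz b n.+1 = b ∘ circz b n by rewrite /circz /= expgS.
  rewrite circ_lambda IHn lambdaD !lambda_zexp bb bd.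
  have -> : addz (b + d) n = addz b n + addz d n by exact: (@expgMn (addgroup Q)).
  rewrite -sbaddA -addzD sbaddA -{1}(addz1 b) -addzD binS bin1 -PoszD.
  by congr (_ + addz d (Posz _)); rewrite addnC.
apply: cn0; rewrite /c F bp sbadd0.
have /dvdnP[q ->] : (p %| 'C(p, 2))%N.
  by apply: prime_dvd_bin => //; have := prime_gt1 pr; lia.
rewrite mulnC PoszM addzM; have -> : addz d p = addz (addz c p) j.
  rewrite dE; exact: (@zexpAC (addgroup Q)).
by rewrite cp !addz0l.
Qed.

End Unipotent.

Section CircIdeals.
Variable B : skewBraceType.
Implicit Types (b x : B).

Lemma circzM b k l : circz b (k * l)%R = circz (circz b k) l.
Proof. exact: zexpM. Qed.

Lemma not_cyclic_circ_multiple b (p : nat) : prime p ->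
  dvd_order (G := B) b p -> ~ cyclic_circ (circz b p) b.
Proof.
move=> pr bp; rewrite -{2}(expg1 b) => /(@cyclic_zexp_dvd B b p 1 bp).
by rewrite dvdzE /= dvdn1 => /eqP p1; have := prime_gt1 pr; rewrite p1.
Qed.

Lemma add_coprime_mem (H : set B) b (k l : int) : @subgroup (addgroup B) H ->
  coprimez k l -> H (addz b k) -> H (addz b l) -> H b.
Proof.
move=> sH /coprimezP[[u v] /= uv] hk hl.
have [_ sD _] := sH; rewrite -(addz1 b) -uv addzD.
apply: sD; rewrite GRing.mulrC addzM; exact: (@subgroup_zexp (addgroup B)).
Qed.

(** Modulo [<b ^ p>] the element [lambda b b] is [b], for every prime [p]; the subgroups [<b ^ p>] of
the infinite cyclic group [<b>] intersect trivially. *)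
Lemma circ_ideals_infinite b : infinite_order_circ b ->
  (forall k : nat, (0 < k)%N -> ideal (cyclic_circ (circz b k))) -> lambda b b = b.
Proof.
move=> binf idb; have cb := @cyclic_subgroup_id B b.
have ib : ideal (cyclic_circ b) by have := idb 1%N isT; rewrite /circz /= expg1.
have [_ HL _] := ib; have /cyclic_circP[i bi] := HL b b cb.
suff i1 : i = 1%R by rewrite bi i1 /circz /= expg1.
apply/eqP; rewrite -GRing.subr_eq0; apply/eqP/dvdz_all_primes => p pr.
have p0 := prime_gt0 pr; have bp := @infinite_dvd_order B b p binf.
have [Q [f [fM fD fK]]] := ideal_quotient (idb p p0).
have := circ_prime_index_lambda pr bp (ideal_add_subgroup ib) (idb p p0) fM fD fK.
rewrite -(morph_lambda fM fD) bi => fb; apply: (cyclic_zexp_dvd bp).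
apply/fK; rewrite zexpD fM fb zexp_opp (morph_inv fM) /= expg1 mulgV.
exact: sbone0.
Qed.

(** Induction on the order [m] of [b]. Let [p] be a prime divisor of [m] and [c = b ^ p]. By induction
[N = <c>] is also additively generated by [c], and Lagrange's theorem modulo [N] gives
[p b = u c]. If [u] is prime to the additive order of [c] then [c] is a multiple of [b], hence so
are the elements of [N]; modulo [N] the powers of [b] are multiples of [b]. Otherwise some prime
[q] divides both, and [p b] lies in the subgroup of index [p q]. If [q] differs from [p], then [p b]
and [q b] both lie in [<b ^ q>], which therefore contains [b]; if [q = p] the quotient by
[<b ^ (p ^ 2)>] is the situation of [no_unipotent]. *)
Lemma circ_odd_ideals m b : has_order (G := B) b m -> odd m ->
  (forall k : nat, (0 < k)%N -> ideal (cyclic_circ (circz b k))) ->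
  cyclic_circ b `<=` cyclic_add b.
Proof.
have [n] := ubnP m; elim: n m b => // n IHn m b ltmn hb om idb.
have [m0 bm _] := hb; have cb := @cyclic_subgroup_id B b.
have ab := @cyclic_subgroup_id (addgroup B) b.
have sab := @cyclic_subgroup_subgroup (addgroup B) b.
have [m1|m1] : m = 1%N \/ (1 < m)%N by lia.
  move=> _ /cyclic_circP[k ->]; rewrite m1 expg1 in bm.
  have -> : circz b k = 0 by rewrite bm /circz zexp1n sbone0.
  by have [] := sab.
have [p pr pm] := pdivP m1; have p0 := prime_gt0 pr; have p1 := prime_gt1 pr.
have op : odd p by exact: dvdn_odd pm om.
have ib : ideal (cyclic_circ b) by have := idb 1%N isT; rewrite /circz /= expg1.
have sb := ideal_add_subgroup ib.
set c := circz b p; have iN : ideal (cyclic_circ c) := idb p p0.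
have hc : has_order (G := B) c (m %/ p) := has_order_expg hb p0 pm.
have sN := ideal_add_subgroup iN; have cc := @cyclic_subgroup_id B c.
have idc (k : nat) : (0 < k)%N -> ideal (cyclic_circ (circz c k)).
  by move=> k0; rewrite -circzM -PoszM; apply: idb; rewrite muln_gt0 p0.
have Nac : cyclic_circ c = cyclic_add c.
  apply/seteqP; split; last exact: (@cyclic_subgroup_sub (addgroup B)).
  apply: (IHn (m %/ p)%N) => //.
    by apply: leq_trans (ltn_Pdiv p1 m0) _; rewrite -ltnS.
  by move: om; rewrite -{1}(divnK pm) oddM => /andP[].
have bp := has_order_dvd_order hb pm.
have Nbp : cyclic_circ c (addz b p) := circ_index_addz p0 bp sb iN.
have [u bu] : exists u, addz b p = addz c u by apply/cyclic_addP; rewrite -Nac.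
have cmp := add_order_dvd_circ hc sN; have mp0 : (0 < m %/ p)%N by have [] := hc.
have [n' hn' n'mp] := @has_order_of_expg (addgroup B) c _ mp0 cmp.
have [n'0 cn' _] := hn'.
have cop : coprimez u n'.
  rewrite coprimezE /coprime /=; apply: contraT => g1.
  have [|q prq] := @pdivP (gcdn `|u| n').
    by rewrite ltn_neqAle eq_sym g1 gcdn_gt0 n'0 orbT.
  rewrite dvdn_gcd => /andP[qu qn']; have q0 := prime_gt0 prq.
  have qmp := dvdn_trans qn' n'mp.
  have cq := has_order_dvd_order hc qmp.
  have Mcq := circ_index_addz q0 cq sN (idc q q0).
  have sM := ideal_add_subgroup (idc q q0).
  have Mbp : cyclic_circ (circz c q) (addz b p).
    rewrite bu; have /dvdzP[u' ->] : (Posz q %| u)%Z by rewrite dvdzE.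
    by rewrite GRing.mulrC addzM; apply: (@subgroup_zexp (addgroup B) _ _ u' sM).
  have pqm : (p * q %| m)%N by rewrite -(divnK pm) mulnC dvdn_pmul2r.
  have [pq|pq] := eqVneq q p; last first.
    have bq : dvd_order (G := B) b q.
      by apply: has_order_dvd_order hb (dvdn_trans _ pqm); rewrite dvdn_mull.
    case: (not_cyclic_circ_multiple prq bq); have iq := idb q q0.
    apply: (@add_coprime_mem _ _ p q (ideal_add_subgroup iq)).
    - by rewrite coprimezE /= prime_coprime // dvdn_prime2 // eq_sym.
    - apply: (cyclic_subgroup_sub (ideal_circ_subgroup iq)) Mbp.
      by rewrite -circzM GRing.mulrC; apply: zexp_in_cyclic; rewrite dvdz_mulr.
    exact: circ_index_addz.
  rewrite pq in cq Mcq sM Mbp pqm idc *.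
  have [Q [f [fM fD fK]]] := ideal_quotient (idc p p0).
  have Nc y : cyclic_circ c y -> exists k, f y = addz (circz (f b) p) k.
    rewrite Nac => /cyclic_addP[k ->]; exists k.
    by rewrite (morph_addz fD) (morph_circz fM).
  have [[_ HCN] HLN _] := iN.
  have [r fr] := Nc _ (HLN b c cc).
  have [s fs] := Nc _ (HCN c b cc).
  have [Q' [f' [fM' fD' fK']]] := ideal_quotient iN.
  have f'b := circ_prime_index_lambda pr bp sb iN fM' fD' fK'.
  have Nbb : cyclic_circ c (- b + lambda b b).
    by apply/fK'; rewrite fD' (morph_lambda fM' fD') f'b (morph_opp fD') sbaddN.
  have [j fj] := Nc _ Nbb.
  have fc : f c = circz (f b) p by rewrite (morph_circz fM).
  have pc := not_cyclic_circ_multiple pr cq.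
  case: (@no_unipotent Q (f b) p j r s pr op); rewrite -?fc.
  - by move/fK.
  - by rewrite -(morph_addz fD); apply/fK.
  - by rewrite -(morph_addz fD); apply/fK.
  - exact: circ_prime_index_lambda pr cq sN (idc p p0) Q f fM fD fK.
  - by rewrite fc -fj fD (morph_lambda fM fD) (morph_opp fD) sbaddVK.
  - by rewrite fc -fr (morph_lambda fM fD) fc.
  rewrite fc -fs; change (- f b + circz (f b) p + f b = f (- b + (c + b))).
  by rewrite !fD (morph_opp fD) fc sbaddA.
have cab : cyclic_add b c.
  apply: (add_coprime_mem sab cop); last by rewrite [addz c n']cn'; have [] := sab.
  by rewrite -bu; apply/cyclic_addP; exists (Posz p).
have Nab : cyclic_circ c `<=` cyclic_add b.
  by rewrite Nac; apply: (@cyclic_subgroup_sub (addgroup B)).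
have [Q [f [fM fD fK]]] := ideal_quotient iN.
have fb := circ_prime_index_lambda pr bp sb iN fM fD fK.
move=> _ /cyclic_circP[k ->]; have [_ sD _] := sab.
rewrite -(sbaddVK (addz b k) (circz b k)); apply: sD.
  by apply/cyclic_addP; exists k.
apply: Nab; apply/fK; rewrite fD (morph_opp fD) (morph_addz fD) (morph_circz fM).
by rewrite circz_lambda_fixed // sbaddN.
Qed.

End CircIdeals.

(** * The two cyclic subgroups coincide, and the elements of infinite order *)

Definition infinite_elements (B : skewBraceType) : set B :=
  [set b : B | infinite_order_add b \/ infinite_order_circ b].

Section CyclicIdeals.
Variable B : skewBraceType.
Hypothesis hB : forall b : B, odd_or_infinite_order b ->
  ideal (cyclic_circ b) \/ ideal (cyclic_add b).
Implicit Types (b x : B).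

(** The multiples [p b] have infinite order too, so [<p b>] is an ideal for every prime [p], and the
multiplier of [lambda b] is 1 modulo every prime. *)
Lemma add_ideal_infinite_lambda b :
  ideal (cyclic_add b) -> infinite_order_add b -> lambda b b = b.
Proof.
move=> ib binf; have cb := @cyclic_subgroup_id (addgroup B) b.
have [r br] := lambda_cyclic_add b ib; rewrite (br _ cb).
suff -> : r = 1%R by rewrite addz1.
apply/eqP; rewrite -GRing.subr_eq0; apply/eqP/dvdz_all_primes => p pr.
apply: (prime_multiple_ideal_lambda pr (br _ cb)).
  have bp : cyclic_add b (addz b p) by apply/cyclic_addP; exists (Posz p).
  apply: (cyclic_add_ideal ib bp); apply: hB; left; right.
  by apply: (@infinite_order_zexp_nat (addgroup B)) => //; exact: prime_gt0.
by apply: not_cyclic_add_multiple => //; apply: infinite_dvd_order.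
Qed.

(** For each prime divisor [p] of [n] the subgroup [<p b>] is an ideal, hence the multiplier [r] of
[lambda b] is 1 modulo [p]. As [b ^ m] is the geometric sum of [m] powers of [r] times [b], the
multiplicative order of [b] is a multiple of [n]. *)
Lemma add_ideal_odd b n : ideal (cyclic_add b) ->
  has_order (G := addgroup B) b n -> odd n -> cyclic_add b = cyclic_circ b.
Proof.
move=> ib hb on; have [r br] := finite_add_order_lambda ib hb.
have [n0 bn minn] := hb; have cb := @cyclic_subgroup_id (addgroup B) b.
have r1 p : prime p -> (p %| n)%N -> r = 1 %[mod p].
  move=> pr pn; have bp : cyclic_add b (addz b p) by apply/cyclic_addP; exists (Posz p).
  have : (Posz p %| (Posz r - 1)%R)%Z.
    apply: (prime_multiple_ideal_lambda pr br).
      apply: (cyclic_add_ideal ib bp); apply: hB; left; left.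
      apply: (@odd_order_of_expg (addgroup B) _ n) => //.
      change (addz (addz b p) n = 0); rewrite -addzM GRing.mulrC addzM.
      by rewrite [addz b n]bn addz0l.
    by apply: not_cyclic_add_multiple => //; apply: has_order_dvd_order hb _.
  by rewrite -eqz_mod_dvd => /eqP; rewrite !modz_nat => -[].
have hc : has_order (G := B) b n.
  have h m : circz b (Posz m) = 1%g -> (n %| m)%N.
    rewrite (circz_geom_sum _ br) sbone0 => /(has_order_dvdn _ hb).
    exact: dvdn_geom_sum.
  split=> //; first exact: add_ideal_circ_expg.
  by move=> m m0 /h/dvdn_leq; apply.
apply/esym; apply: (equal_orders_circ_sub_add hb hc).
exact: cyclic_circ_sub_add ib cb.
Qed.

Lemma add_ideal_cyclic_eq b : odd_or_infinite_order b -> ideal (cyclic_add b) ->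
  cyclic_add b = cyclic_circ b.
Proof.
move=> ob ib; have [[n hb]|binf] := pselect (exists n, has_order (G := addgroup B) b n); last first.
  by apply: lambda_fixed_cyclic_eq; apply: add_ideal_infinite_lambda.
case on : (odd n); first exact: add_ideal_odd ib hb on.
have ev m := @add_ideal_even_circ B b n m ib hb (negbT on).
case: ob => [[[m hm]|]|[[m [m0 bm _] om]|]].
- by rewrite (has_order_unique hm hb) on.
- by case; exists n.
- by have := ev m bm; rewrite om.
have [n0 _ _] := hb; have [m hm _] := has_order_of_expg n0 (add_ideal_circ_expg ib hb).
by case; exists m.
Qed.

Lemma cyclic_circ_ideal b : odd_or_infinite_order b -> ideal (cyclic_circ b).
Proof.
by move=> ob; have [//|ib] := hB ob; rewrite -(add_ideal_cyclic_eq ob ib).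
Qed.

Lemma circ_odd_expg_ideal b m (k : nat) :
  circz b (Posz m) = 1%g -> odd m -> ideal (cyclic_circ (circz b k)).
Proof.
move=> bm om; apply: cyclic_circ_ideal; right; left.
apply: (@odd_order_of_expg B _ m) => //; change (circz (circz b k) m = 1%g).
by rewrite -circzM GRing.mulrC circzM bm /circz zexp1n.
Qed.

(** Let [k] be the largest power of 2 dividing [m]. Then [b ^ k] has odd order and generates an ideal,
which contains [k b] by Lagrange's theorem and [n b = 0], hence [b] itself; so [k = 1]. *)
Lemma circ_order_odd b m n : ideal (cyclic_circ b) -> has_order (G := B) b m ->
  addz b (Posz n) = 0 -> odd n -> odd m.
Proof.
move=> ib hb bn on; have [m0 bm _] := hb; set k := (m`_2)%N.
have k0 : (0 < k)%N by exact: part_gt0.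
have mE : (k * m`_2^')%N = m by exact: partnC.
have ik : ideal (cyclic_circ (circz b k)).
  apply: cyclic_circ_ideal; right; left.
  apply: (@odd_order_of_expg B _ (m`_2^')).
    by change (circz (circz b k) (m`_2^')%N = 1%g); rewrite -circzM -PoszM mE.
  by rewrite odd_2'nat part_pnat.
have bk : dvd_order (G := B) b k by apply: has_order_dvd_order hb _; rewrite dvdn_part.
have bkb : cyclic_circ (circz b k) b.
  apply: (@add_coprime_mem _ _ _ k n (ideal_add_subgroup ik)).
  - rewrite coprimezE /= coprime_sym; apply: (@pnat_coprime 2^') => //.
      by rewrite -odd_2'nat.
    by rewrite pnatNK part_pnat.
  - exact: circ_index_addz bk (ideal_add_subgroup ib) ik.
  by rewrite bn; have [] := ideal_add_subgroup ik.
have : (Posz k %| 1)%Z by apply: (cyclic_zexp_dvd bk); rewrite /= expg1.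
rewrite dvdzE /= dvdn1 => /eqP k1.
by rewrite -mE k1 mul1n odd_2'nat part_pnat.
Qed.

Lemma infinite_order_lambda b :
  infinite_order_add b \/ infinite_order_circ b -> lambda b b = b.
Proof.
move=> bi; have ob : odd_or_infinite_order b by case: bi; [left; right|right; right].
have [binf|bfin] := pselect (infinite_order_circ b).
  apply: circ_ideals_infinite => // k k0; apply: cyclic_circ_ideal; right; right.
  exact: infinite_order_zexp_nat.
have binf : infinite_order_add b by case: bi.
have [m hm] : exists m, has_order (G := B) b m by apply: contrapT.
have [m0 _ _] := hm.
have bm := add_order_dvd_circ hm (ideal_add_subgroup (cyclic_circ_ideal ob)).
have [n hn _] := @has_order_of_expg (addgroup B) b m m0 bm.
by case: binf; exists n.
Qed.

Lemma odd_or_infinite_cyclic_eq b :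
  odd_or_infinite_order b -> cyclic_add b = cyclic_circ b.
Proof.
move=> ob; have ib := cyclic_circ_ideal ob.
have [/infinite_order_lambda/lambda_fixed_cyclic_eq //|fin] :=
  pselect (infinite_order_add b \/ infinite_order_circ b).
have [m hm] : exists m, has_order (G := B) b m.
  by apply: contrapT => h; apply: fin; right.
have [m0 bm _] := hm.
have om : odd m.
  case: ob => [[[n hn on]|h]|[[n hn on]|h]].
  - by have [_ bn _] := hn; apply: circ_order_odd ib hm bn on.
  - by case: fin; left.
  - by rewrite (has_order_unique hm hn).
  - by case: fin; right.
apply/seteqP; split.
  apply: (@cyclic_subgroup_sub (addgroup B)); first exact: ideal_add_subgroup.
  exact: (@cyclic_subgroup_id B).
by apply: (circ_odd_ideals hm om) => k _; apply: circ_odd_expg_ideal bm om.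
Qed.

Lemma infinite_ideal b : infinite_elements b -> ideal (cyclic_add b).
Proof.
move=> bi; have ob : odd_or_infinite_order b by case: bi; [left; right|right; right].
by rewrite odd_or_infinite_cyclic_eq //; apply: cyclic_circ_ideal.
Qed.

Lemma infinite_addz b k : infinite_elements b -> addz b k = 0 -> k = 0%R.
Proof.
move=> bi; have bb := infinite_order_lambda bi; case: bi => bi bk.
  exact: (@infinite_order_zexp (addgroup B)) bi bk.
apply: (@infinite_order_zexp B) bi _; change (circz b k = 1%g).
by rewrite circz_lambda_fixed // bk sbone0.
Qed.

(** If the ideals generated by [b] and [c] meet trivially, [lambda c] fixes the first one. Otherwise
[lambda c] fixes a nonzero multiple of [b], because it is trivial on the multiples of [c], and a
multiplication of an infinite cyclic group that fixes a nonzero element is the identity. *)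
Lemma infinite_lambda b c : infinite_elements b -> infinite_elements c -> lambda c b = b.
Proof.
move=> bi ci; have ib := infinite_ideal bi; have ic := infinite_ideal ci.
have bb := @cyclic_subgroup_id (addgroup B) b.
have cc := @cyclic_subgroup_id (addgroup B) c.
have [[x [bx cx xn0]]|h] := pselect (exists x, [/\ cyclic_add b x, cyclic_add c x & x <> 0]);
  last first.
  apply: (disjoint_ideals_lambda ib ic) => // y by_ cy.
  by apply: contrapT => yn0; apply: h; exists y.
have [r rE] := lambda_cyclic_add c ib; rewrite (rE _ bb).
have xr : addz x r = x.
  rewrite -(rE _ bx); move: cx => /cyclic_addP[l ->].
  by rewrite lambda_zexp infinite_order_lambda.
have [u xu] : exists u, x = addz b u by apply/cyclic_addP.
have : addz b (u * r - u)%R = 0.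
  by rewrite addzD addzM -xu xr xu -addzD GRing.subrr.
move=> /(infinite_addz bi) h.
have un0 : u <> 0%R by move=> u0; apply: xn0; rewrite xu u0.
by have -> : r = 1%R by nia; rewrite addz1.
Qed.

(** The additive subgroup [A] generated by the elements of infinite order is already a trivial sub-skew
brace. The elements of [A] whose [lambda] fixes [A] pointwise form an additive subgroup, since
on them the two operations agree, and this subgroup contains the generators. *)
Lemma infinite_generated_trivial : trivial_brace (generated_sub_skew_brace (@infinite_elements B)).
Proof.
pose A : set B := smallest (@subgroup (addgroup B)) (@infinite_elements B).
have sA : @subgroup (addgroup B) A := @smallest_subgroup (addgroup B) _.
have [A0 AD AN] := sA.
have step1 s x : infinite_elements s -> A x -> lambda s x = x.
  move=> si; apply: (@smallest_sub _ _ _ [set x | lambda s x = x]); last first.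
    by move=> y yi; apply: infinite_lambda.
  split=> [|y z hy hz|y hy] /=; first exact: lambda_r0.
  - by change (lambda s (y + z) = y + z); rewrite lambdaD hy hz.
  - have := @morph_inv (addgroup B) (addgroup B) _ (lambdaD s) y.
    by rewrite [lambda s y]hy.
pose F := [set a : B | A a /\ forall x, A x -> lambda a x = x].
have FD (y z : B) : F y -> F z -> F (y + z).
  move=> [Ay hy] [Az hz]; split=> [|x Ax]; first exact: AD.
  have -> : y + z = y ∘ z by rewrite circ_lambda hy.
  by rewrite lambda_circ hz ?hy.
have FN (y : B) : F y -> F (- y).
  move=> [Ay hy]; split=> [|x Ax]; first exact: AN.
  have -> : - y = (y^-1)%g; last by rewrite -{1}(hy x Ax) lambdaK.
  apply: (can_inj (mulKg y)); rewrite mulgV circ_lambda hy ?sbaddrN ?sbone0 //.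
  exact: AN.
have step2 a x : A a -> A x -> lambda a x = x.
  move=> Aa; suff [_ h] : F a by exact: h.
  apply: (@smallest_sub _ (@subgroup (addgroup B)) (@infinite_elements B) F _ _ a Aa) => [|s si].
    by split=> //; split=> // z _; apply: lambda0.
  by split=> [|z]; [exact: sub_gen_smallest | exact: step1].
have sbA : sub_skew_brace A.
  split=> //; apply: lambda_closed_subgroup => // a x Aa Ax.
    by rewrite step2.
  by rewrite -{1}(step2 a x Aa Ax) lambdaK.
have sub : generated_sub_skew_brace (@infinite_elements B) `<=` A.
  by apply: smallest_sub => //; exact: sub_gen_smallest.
by move=> a x /sub Aa /sub Ax; rewrite circ_lambda step2.
Qed.

End CyclicIdeals.

Theorem theorem4p15 (B : skewBraceType)
    (hB : forall b : B, odd_or_infinite_order b ->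
            ideal (cyclic_circ b) \/ ideal (cyclic_add b)) :
  (forall b : B, odd_or_infinite_order b -> cyclic_add b = cyclic_circ b) /\
  trivial_brace
    (generated_sub_skew_brace
       [set b : B | infinite_order_add b \/ infinite_order_circ b]).
Proof.
split; first exact: odd_or_infinite_cyclic_eq.
exact: infinite_generated_trivial.
Qed.
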